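(* Let $\mathcal{C}$ be a uniform clutter (all edges have the same cardinality) and assume $q\geq 3$. Let $L\subset\mathbb{Z}^n$ be the subgroup generated by $v_2-v_1,\ldots,v_s-v_1$ and let $\phi:\mathbb{Z}^n/L\to\mathbb{Z}^n/L$ be the multiplication map $\phi(\overline{a})=(q-1)\overline{a}$. Then $I(X)$ is a complete intersection (i.e. generated by $s-1$ homogeneous polynomials) if and only if $v_1,\ldots,v_s$ are linearly independent and $\phi$ is injective.
   Context: Let $K=\mathbb{F}_q$ be a finite field. A clutter $\mathcal{C}$ with vertex set $\{y_1,\ldots,y_n\}$ is a family of subsets (edges) of this set such that no edge is contained in another; let its edges be $f_1,\ldots,f_s$ ($s\geq 2$) with characteristic vectors $v_i=\sum_{y_j\in f_i}e_j\in\{0,1\}^n$. For $x\in K^n$ write $x^{v_i}=\prod_j x_j^{v_{ij}}$. Let $X=\{[(x^{v_1},\ldots,x^{v_s})]\in\mathbb{P}^{s-1}: x\in (K^* )^n\}$, let $S=K[t_1,\ldots,t_s]$ with the standard grading, and let $I(X)$ be the ideal of $S$ generated by the homogeneous polynomials vanishing on $X$. *)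

(* Defs.v *)
From HB Require Import structures.
From mathcomp Require Import all_boot all_order all_algebra all_field.
Set Implicit Arguments. Unset Strict Implicit. Unset Printing Implicit Defensive.
Import Order.TTheory GRing.Theory Num.Theory.
Local Open Scope ring_scope.

Definition mon (s : nat) := {ffun 'I_s -> nat}.
Definition mon_add s (a b : mon s) : mon s := [ffun i => (a i + b i)%N].
Definition mdeg s (a : mon s) : nat := (\sum_i a i)%N.

Definition mpoly (K : fieldType) (s : nat) := seq (mon s * K).

Definition mcoef (K : fieldType) s (p : mpoly K s) (m : mon s) : K :=
  \sum_(t <- p | t.1 == m) t.2.

Definition peq (K : fieldType) s (p q : mpoly K s) : Prop :=
  forall m, mcoef p m = mcoef q m.

Definition pmul (K : fieldType) s (p q : mpoly K s) : mpoly K s :=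
  [seq (mon_add t.1 u.1, t.2 * u.2) | t <- p, u <- q].

Definition plincomb (K : fieldType) s k (h g : 'I_k -> mpoly K s) : mpoly K s :=
  flatten [seq pmul (h i) (g i) | i <- enum 'I_k].

Definition homogeneous (K : fieldType) s (p : mpoly K s) : Prop :=
  exists d, forall m, mcoef p m != 0 -> mdeg m = d.

Definition peval (K : fieldType) s (p : mpoly K s) (y : 'I_s -> K) : K :=
  \sum_(t <- p) t.2 * \prod_i y i ^+ t.1 i.

Definition in_ideal (K : fieldType) s k (g : 'I_k -> mpoly K s) (p : mpoly K s) : Prop :=
  exists h : 'I_k -> mpoly K s, peq p (plincomb h g).

Definition is_clutter n s (f : 'I_s -> {set 'I_n}) : Prop :=
  forall i j, i != j -> ~~ (f i \subset f j).
Definition uniform_clutter n s (f : 'I_s -> {set 'I_n}) : Prop :=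
  forall i j, #|f i| = #|f j|.

Definition charvec n s (f : 'I_s -> {set 'I_n}) (i : 'I_s) (j : 'I_n) : int :=
  (j \in f i)%:Z.

(* the affine point (x^{v_1}, ..., x^{v_s}) representing a point of X *)
Definition torus_pt (K : fieldType) n s (f : 'I_s -> {set 'I_n}) (x : 'I_n -> K)
  : 'I_s -> K := fun i => \prod_(j in f i) x j.

(* homogeneous polynomial vanishing on X (vanishing at one representative of a
   projective point is independent of the representative for homogeneous p) *)
Definition vanishes_on_X (K : fieldType) n s (f : 'I_s -> {set 'I_n}) (p : mpoly K s) : Prop :=
  forall x : 'I_n -> K, (forall j, x j != 0) -> peval p (torus_pt f x) = 0.

Definition in_IX (K : fieldType) n s (f : 'I_s -> {set 'I_n}) (p : mpoly K s) : Prop :=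
  exists (k : nat) (g : 'I_k -> mpoly K s),
    (forall i, homogeneous (g i) /\ vanishes_on_X f (g i)) /\ in_ideal g p.

Definition IX_complete_intersection (K : fieldType) n s (f : 'I_s -> {set 'I_n}) : Prop :=
  exists g : 'I_(s.-1) -> mpoly K s,
    (forall i, homogeneous (g i)) /\ (forall p, in_IX f p <-> in_ideal g p).

Definition charmx n s (f : 'I_s -> {set 'I_n}) : 'M[rat]_(s, n) :=
  \matrix_(i, j) ((j \in f i)%:R).

Definition inL n s (f : 'I_s -> {set 'I_n}) (i0 : 'I_s) (a : 'I_n -> int) : Prop :=
  exists c : 'I_s -> int,
    forall j, a j = \sum_(i | i != i0) c i * (charvec f i j - charvec f i0 j).

Definition phi_injective n s (f : 'I_s -> {set 'I_n}) (i0 : 'I_s) (q : nat) : Prop :=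
  forall a b : 'I_n -> int,
    inL f i0 (fun j => (q.-1)%:Z * a j - (q.-1)%:Z * b j) ->
    inL f i0 (fun j => a j - b j).

(* Main.v *)
Require Import Defs.
From HB Require Import structures.
From mathcomp Require Import all_boot all_order all_algebra all_field.
From mathcomp Require Import zify ring.
Set Implicit Arguments. Unset Strict Implicit. Unset Printing Implicit Defensive.
Import Order.TTheory GRing.Theory Num.Theory.
Local Open Scope ring_scope.

(** Write [N = q - 1] and let [T] be the projective torus, so that [X] is a
    subgroup of [T].  By duality of finite abelian groups, the condition on the
    [v_i] and on [phi] says exactly that [X = T] ([indep_mod]); and [I(T)] is
    generated by the [s - 1] binomials [t_i ^ N - t_1 ^ N].

    Conversely let [I(X)] be generated by [s - 1] homogeneous polynomials.  A form
    of degree [d < N] in [I(X)] has no pure power [t_i ^ d]: by independence of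
    characters it would contain another monomial with exponent [d v_i] in [x], and
    all edges occurring in it would contain [f_i], which a clutter forbids.
    Hence the [s - 1] binomials [t_i ^ N - t_1 ^ N] are linearly independent in
    [I(X) / m I(X)], where [m = (t_1, ..., t_s)], so they generate [I(X)], and
    [I(X) = I(T)] forces [X = T]. *)

(** * Power sums over the units of a finite field *)

Section CharacterSums.
Variable K : finFieldType.
Local Notation N := (#|K|.-1).

Lemma card_units_gt0 : (0 < N)%N.
Proof. by rewrite -ltnS prednK ?finNzRing_gt1 // ltnW ?finNzRing_gt1. Qed.

Lemma succ_card_units : N.+1 = #|K|.
Proof. by rewrite prednK // ltnW ?finNzRing_gt1. Qed.

Lemma unit_expf_card (z : K) : z != 0 -> z ^+ N = 1.
Proof.
move=> z0; apply: (mulfI z0); rewrite -exprS mulr1.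
by rewrite succ_card_units expf_card.
Qed.

Lemma unit_expf_mod (z : K) e : z != 0 -> z ^+ e = z ^+ (e %% N).
Proof.
move=> z0; rewrite {1}(divn_eq e N) exprD mulnC exprM unit_expf_card //.
by rewrite expr1n mul1r.
Qed.

(** A polynomial [X^r - 1] with 0 < r < N cannot have all N units as roots. *)
Lemma dvdn_unit_exp e : (forall z : K, z != 0 -> z ^+ e = 1) -> (N %| e)%N.
Proof.
move=> He; rewrite /dvdn; set r := (e %% N)%N; case: (posnP r) => [//|r0].
have rlt : (r < N)%N by rewrite ltn_pmod // card_units_gt0.
have sz : size ('X^r - 1%:P : {poly K}) = r.+1 by rewrite size_XnsubC.
have p0 : 'X^r - 1%:P != 0 :> {poly K} by rewrite -size_poly_eq0 sz.
have := max_poly_roots p0 (rs := enum [pred z : K | z != 0]).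
rewrite sz -cardE (@eq_card _ _ (predC1 (0 : K))) // cardC1.
suff allr : all (root ('X^r - 1%:P)) (enum [pred z : K | z != 0]).
  by move/(_ allr (enum_uniq _)); rewrite ltnS leqNgt rlt.
apply/allP => z; rewrite mem_enum inE => z0.
by rewrite rootE !hornerE -unit_expf_mod // He // subrr.
Qed.

(** Translation by 1 permutes the field, so adding 1 to every element does not change the sum of all
    elements. *)
Lemma card_finField_natr : #|K|%:R = 0 :> K.
Proof.
have : \sum_(z : K) (z + 1) = \sum_(z : K) z.
  by rewrite [RHS](reindex_inj (addIr 1)).
rewrite big_split /= sumr_const => /eqP.
by rewrite -subr_eq0 addrAC subrr add0r => /eqP.
Qed.

(** If N divides e, all N summands are 1, and N = -1 in K. Otherwise some unit z has z ^ e != 1, and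
    multiplication by z permutes the units while scaling the sum by z ^ e. *)
Lemma sum_unit_exp e :
  \sum_(z : K | z != 0) z ^+ e = if (N %| e)%N then -1 else 0.
Proof.
case: ifP => [/dvdnP [k ->]|ndiv].
  rewrite (eq_bigr (fun=> 1)) => [|z z0]; last first.
    by rewrite mulnC exprM unit_expf_card // expr1n.
  rewrite sumr_const (@eq_card _ _ (predC1 (0 : K))) // cardC1.
  apply/eqP; rewrite -addr_eq0 natr1 succ_card_units.
  by rewrite card_finField_natr.
have [z /andP [z0 ze]|all1] := pickP [pred z : K | (z != 0) && (z ^+ e != 1)].
  rewrite -subr_eq0 in ze.
  apply: (mulfI ze); rewrite mulr0 mulrBl mul1r mulr_sumr; apply/eqP.
  rewrite subr_eq0 [X in _ == X](reindex_inj (mulfI z0)) /=.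
  apply/eqP/eq_big => [w|w _]; last by rewrite exprMn.
  by rewrite mulf_eq0 (negbTE z0).
case/negP: (negbT ndiv); apply: dvdn_unit_exp => z z0.
by have := all1 z; rewrite /= z0 => /negbFE/eqP.
Qed.

(* The sum against the character inverse to [a] isolates one class. *)
Lemma vanish_torus_class n (p : mpoly K n) (a : 'I_n -> nat) :
  (forall x : 'I_n -> K, (forall j, x j != 0) -> peval p x = 0) ->
  \sum_(t <- p | [forall j, t.1 j == a j %[mod N]]) t.2 = 0.
Proof.
move=> vp.
have N0 := card_units_gt0.
(* As [N.-1] is -1 modulo N, the natural number [N.-1 * a j] serves as the exponent -a_j. *)
have dvdE (t : mon n * K) j :
    (t.1 j == a j %[mod N]) = (N %| t.1 j + N.-1 * a j)%N.
  rewrite -(eqn_modDr (N.-1 * a j)) -mulSn prednK //.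
  by rewrite modnMr.
have: \sum_(x in ffun_on [pred z : K | z != 0])
    (\prod_j x j ^+ (N.-1 * a j)) * peval p x = 0.
  by rewrite big1 // => x /ffun_onP xP; rewrite vp ?mulr0.
rewrite /peval; under eq_bigr do rewrite mulr_sumr.
rewrite exchange_big /=.
under eq_bigr => t _.
  under eq_bigr => x _ do
    rewrite mulrCA -big_split /=.
  rewrite -mulr_sumr.
  under eq_bigr => x _ do
    under eq_bigr => j _ do rewrite -exprD addnC.
  (* The sum over the torus factors into one-variable sums, each -1 or 0; surviving terms thus carry
     the sign (-1)^n removed below. *)
  have := @bigA_distr_big _ 0 1 *%R +%R 'I_n K [pred z : K | z != 0]
    (fun j z => z ^+ (t.1 j + N.-1 * a j)).
  move=> /= <-.
  under eq_bigr => j _ do rewrite sum_unit_exp -dvdE.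
  over.
move=> /= h; have m1 : (-1 : K) ^+ n != 0 by rewrite expf_neq0 // oppr_eq0 oner_eq0.
apply: (mulIf m1); rewrite mul0r -[RHS]h mulr_suml [LHS]big_mkcond /=.
apply: eq_bigr => t _; case: ifP => [/forallP tP|/negbT].
  by under eq_bigr => j _ do rewrite tP; rewrite prodr_const card_ord.
rewrite negb_forall => /existsP [j /negbTE tj].
by rewrite (bigD1 j) //= tj mul0r mulr0.
Qed.
End CharacterSums.

(** * Polynomials seen through linear functionals *)

Section LinearFunctionals.
Variables (K : fieldType) (s : nat).
Implicit Types (p q : mpoly K s) (F G : mon s -> K).

(** The linear functional with value [F] on monomials, applied to [p]. Coefficients and evaluations
    are both of this form, and it does not depend on how [p] is listed as terms ([peqP]). *)
Definition psum p F : K := \sum_(t <- p) t.2 * F t.1.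

Lemma eq_psum p F G : F =1 G -> psum p F = psum p G.
Proof. by move=> FG; apply: eq_bigr => t _; rewrite FG. Qed.

Lemma mcoefE p m : mcoef p m = psum p (fun m' => (m' == m)%:R).
Proof.
rewrite /mcoef /psum big_mkcond; apply: eq_bigr => t _.
by case: eqP; rewrite ?mulr1 ?mulr0.
Qed.

Lemma pevalE p y : peval p y = psum p (fun m => \prod_i y i ^+ m i).
Proof. by []. Qed.

Lemma psum_support p F (r : seq (mon s)) :
  uniq r -> {subset [seq t.1 | t <- p] <= r} ->
  psum p F = \sum_(m <- r) mcoef p m * F m.
Proof.
move=> ur sub; under eq_bigr => m _ do rewrite mcoefE mulr_suml.
rewrite exchange_big /= /psum [LHS]big_seq [RHS]big_seq.
apply: eq_bigr => t tp.
have tr : t.1 \in r by apply: sub; apply: map_f.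
rewrite (bigD1_seq t.1) //= eqxx mulr1 big1 ?addr0 // => m.
by rewrite eq_sym => /negbTE ->; rewrite mulr0 mul0r.
Qed.

Lemma peqP p q : peq p q <-> psum p =1 psum q.
Proof.
split=> [pq F|pq m]; last by rewrite !mcoefE.
rewrite !(@psum_support _ F (undup [seq t.1 | t <- p ++ q])) ?undup_uniq //.
- by apply: eq_bigr => m _; rewrite pq.
- by move=> m mq; rewrite mem_undup map_cat mem_cat mq orbT.
by move=> m mq; rewrite mem_undup map_cat mem_cat mq.
Qed.

(** Listed terms may cancel; this allows hypotheses on true coefficients, such as homogeneity, to be
    used inside a functional. *)
Lemma eq_psum_coef p F G :
  (forall m, mcoef p m != 0 -> F m = G m) -> psum p F = psum p G.
Proof.
move=> FG; rewrite !(@psum_support p _ (undup [seq t.1 | t <- p])) ?undup_uniq //;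
  try by move=> m; rewrite mem_undup.
apply: eq_bigr => m _; have [->|/FG -> //] := eqVneq (mcoef p m) 0.
by rewrite !mul0r.
Qed.

Lemma psum_cond p (P : pred (mon s)) :
  \sum_(t <- p | P t.1) t.2 = psum p (fun m => (P m)%:R).
Proof.
rewrite /psum big_mkcond; apply: eq_bigr => t _.
by case: (P _); rewrite ?mulr1 ?mulr0.
Qed.

Lemma psum_cat p q F : psum (p ++ q) F = psum p F + psum q F.
Proof. exact: big_cat. Qed.

Lemma psum_nil F : psum [::] F = 0.
Proof. exact: big_nil. Qed.

Lemma psum_cons t p F : psum (t :: p) F = t.2 * F t.1 + psum p F.
Proof. exact: big_cons. Qed.

Lemma psumZ p (c : K) F : psum p (fun m => c * F m) = c * psum p F.
Proof. by rewrite /psum mulr_sumr; apply: eq_bigr => t _; rewrite mulrCA. Qed.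

Lemma psum_sum p I (r : seq I) (F : I -> mon s -> K) :
  psum p (fun m => \sum_(i <- r) F i m) = \sum_(i <- r) psum p (F i).
Proof.
by rewrite /psum exchange_big; apply: eq_bigr => t _; rewrite mulr_sumr.
Qed.

Lemma psum_pmul p q F :
  psum (pmul p q) F = psum p (fun a => psum q (fun b => F (mon_add a b))).
Proof.
rewrite /psum /pmul big_allpairs_dep; apply: eq_bigr => t _.
by rewrite mulr_sumr; apply: eq_bigr => u _; rewrite mulrA.
Qed.

Lemma psum_plincomb k (h g : 'I_k -> mpoly K s) F :
  psum (plincomb h g) F =
  \sum_i psum (h i) (fun a => psum (g i) (fun b => F (mon_add a b))).
Proof.
rewrite /psum /plincomb big_flatten big_map big_enum.
by apply: eq_bigr => i _; apply: psum_pmul.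
Qed.

Lemma mon_addC : commutative (@mon_add s).
Proof. by move=> a b; apply/ffunP => i; rewrite !ffunE addnC. Qed.

Lemma mon_addA : associative (@mon_add s).
Proof. by move=> a b c; apply/ffunP => i; rewrite !ffunE addnA. Qed.

Definition mon0 : mon s := [ffun=> 0%N].

Lemma mon_add0m : left_id mon0 (@mon_add s).
Proof. by move=> a; apply/ffunP => i; rewrite !ffunE. Qed.

Lemma mdeg_add (a b : mon s) : mdeg (mon_add a b) = (mdeg a + mdeg b)%N.
Proof. by rewrite /mdeg -big_split; apply: eq_bigr => i _; rewrite ffunE. Qed.

Lemma mdeg_eq0 (a : mon s) : (mdeg a == 0%N) = (a == mon0).
Proof.
rewrite /mdeg sum_nat_eq0; apply/forallP/eqP => [h|-> i]; last by rewrite ffunE.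
by apply/ffunP => i; rewrite ffunE; apply/eqP; have := h i.
Qed.

Definition mpow (i : 'I_s) (d : nat) : mon s := [ffun j => if j == i then d else 0%N].

Lemma mdeg_mpow i d : mdeg (mpow i d) = d.
Proof.
rewrite /mdeg (bigD1 i) //= ffunE eqxx big1 ?addn0 // => j /negbTE ji.
by rewrite ffunE ji.
Qed.

Lemma mpow0 i : mpow i 0 = mon0.
Proof. by apply/ffunP => j; rewrite !ffunE if_same. Qed.

Lemma mpow_add i d e : mpow i (d + e) = mon_add (mpow i d) (mpow i e).
Proof. by apply/ffunP => j; rewrite !ffunE; case: ifP. Qed.

Lemma mon_add_mpow (a b : mon s) i d :
  mon_add a b = mpow i d -> a = mpow i (mdeg a) /\ b = mpow i (mdeg b).
Proof.
have zero (c c' : mon s) : mon_add c c' = mpow i d -> c = mpow i (mdeg c).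
  move=> cc'; have c0 j : j != i -> c j = 0%N.
    move=> /negbTE ji; move/ffunP/(_ j): cc'; rewrite !ffunE ji => /eqP.
    by rewrite addn_eq0 => /andP [/eqP].
  apply/ffunP => j; rewrite ffunE; case: (eqVneq j i) => [->|/c0 //].
  by rewrite /mdeg (bigD1 i) //= big1 ?addn0 // => l /c0.
by move=> ab; split; [apply: (zero a b)|apply: (zero b a); rewrite mon_addC].
Qed.

Lemma prod_mpow (y : 'I_s -> K) i d : \prod_j y j ^+ mpow i d j = y i ^+ d.
Proof.
rewrite (bigD1 i) //= ffunE eqxx big1 ?mulr1 // => j /negbTE ji.
by rewrite ffunE ji.
Qed.

End LinearFunctionals.

(** * Ideal membership *)

Section Ideals.
Variables (K : fieldType) (s k : nat) (g : 'I_k -> mpoly K s).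
Implicit Types p q : mpoly K s.

Lemma in_idealP p :
  in_ideal g p <-> exists h : 'I_k -> mpoly K s, forall F, psum p F =
    \sum_i psum (h i) (fun a => psum (g i) (fun b => F (mon_add a b))).
Proof.
by split=> -[h hP]; exists h; [move=> F; move/peqP: hP => ->|
  apply/peqP => F]; rewrite psum_plincomb.
Qed.

Lemma in_ideal_peq p q : peq p q -> in_ideal g q -> in_ideal g p.
Proof. by move=> pq [h hq]; exists h => m; rewrite pq. Qed.

Lemma in_ideal0 : in_ideal g [::].
Proof.
apply/in_idealP; exists (fun=> [::]) => F.
by rewrite psum_nil big1 // => i _; rewrite psum_nil.
Qed.

Lemma in_ideal_cat p q : in_ideal g p -> in_ideal g q -> in_ideal g (p ++ q).
Proof.
move=> /in_idealP [h hP] /in_idealP [h' hP']; apply/in_idealP.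
exists (fun i => h i ++ h' i) => F.
by rewrite psum_cat hP hP' -big_split; apply: eq_bigr => i _; rewrite psum_cat.
Qed.

Lemma in_ideal_mul q p : in_ideal g p -> in_ideal g (pmul q p).
Proof.
move=> /in_idealP [h hP]; apply/in_idealP.
exists (fun i => pmul q (h i)) => F; rewrite psum_pmul.
under eq_psum => a do rewrite hP.
rewrite psum_sum; apply: eq_bigr => i _; rewrite psum_pmul.
by do 3![apply: eq_psum => ?]; rewrite mon_addA.
Qed.

Lemma in_ideal_gen i : in_ideal g (g i).
Proof.
apply/in_idealP; exists (fun j => if j == i then [:: (mon0 s, 1)] else [::]) => F.
rewrite (bigD1 i) //= eqxx big1 => [|j /negbTE ->]; last by rewrite psum_nil.
rewrite psum_cons psum_nil /= mul1r !addr0.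
by apply: eq_psum => b; rewrite mon_add0m.
Qed.

Lemma in_ideal_comb l (h p : 'I_l -> mpoly K s) :
  (forall i, in_ideal g (p i)) -> in_ideal g (plincomb h p).
Proof.
move=> gp; rewrite /plincomb; elim: (enum _) => [|i r IH] /=.
  exact: in_ideal0.
exact/in_ideal_cat/IH/in_ideal_mul.
Qed.

Lemma peval_in_ideal p (y : 'I_s -> K) :
  (forall i, peval (g i) y = 0) -> in_ideal g p -> peval p y = 0.
Proof.
move=> gy /in_idealP [h hP]; rewrite pevalE hP big1 // => i _.
under eq_psum => a.
  under eq_psum => b.
    under eq_bigr => j _ do rewrite ffunE exprD.
    rewrite big_split.
    over.
  rewrite psumZ /= -pevalE gy mulr0.
  over.
by rewrite /psum big1 // => t _; rewrite mulr0.
Qed.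

End Ideals.

(** * The monomial parametrization of X *)

Section ToricSet.
Variables (K : finFieldType) (n s : nat) (f : 'I_s -> {set 'I_n}).
Local Notation N := (#|K|.-1).

(* [x ^ (toric_exp m)] is the monomial [m] evaluated at [(x^{v_1}, ..., x^{v_s})]. *)
Definition toric_exp (m : mon s) : mon n :=
  [ffun j => \sum_i m i * (j \in f i)]%N.

Lemma prod_torus_pt (x : 'I_n -> K) (m : mon s) :
  \prod_i torus_pt f x i ^+ m i = \prod_j x j ^+ toric_exp m j.
Proof.
under [RHS]eq_bigr => j _ do rewrite ffunE expr_sum.
rewrite exchange_big /=; apply: eq_bigr => i _.
rewrite /torus_pt -prodrXl big_mkcond; apply: eq_bigr => j _.
by case: (j \in f i); rewrite ?muln1 ?muln0 ?expr0.
Qed.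

(** Substituting t_i = x^{v_i} gives a polynomial in x that vanishes on the whole torus, to which
    [vanish_torus_class] applies. *)
Lemma vanishes_class (p : mpoly K s) (a : 'I_n -> nat) :
  vanishes_on_X f p ->
  psum p (fun m => [forall j, toric_exp m j == a j %[mod N]]%:R) = 0.
Proof.
move=> vp.
have := @vanish_torus_class K n [seq (toric_exp t.1, t.2) | t <- p] a.
rewrite big_map /= -psum_cond; apply => x x0.
rewrite -[RHS](vp x x0) /peval big_map; apply: eq_bigr => t _.
by rewrite prod_torus_pt.
Qed.

End ToricSet.

(** * Linear independence, injectivity of phi, and independence modulo N *)

Section Lattice.
Variables (n s : nat) (f : 'I_s -> {set 'I_n}).

(** For the converse, a rational relation is made integral by multiplying it by the product of all
    its denominators. *)
Lemma row_free_charmxP :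
  row_free (charmx f) <->
  (forall c : 'I_s -> int, (forall j, \sum_i c i * charvec f i j = 0) ->
   forall i, c i = 0).
Proof.
split=> [rf c c0 i|indep].
  have : (\row_i (c i)%:~R : 'rV[rat]_s) *m charmx f == 0.
    apply/eqP/rowP => j; rewrite !mxE.
    rewrite -[RHS]/((0 : int)%:~R) -(c0 j) rmorph_sum; apply: eq_bigr => l _.
    by rewrite !mxE rmorphM.
  rewrite mulmx_free_eq0 // => /eqP/rowP/(_ i); rewrite !mxE => /eqP.
  by rewrite intr_eq0 => /eqP.
rewrite -kermx_eq0; apply/eqP/row_matrixP => l; rewrite row0.
set u := row l _.
have uA : u *m charmx f = 0 by rewrite -row_mul mulmx_ker row0.
pose c i := numq (u 0 i) * \prod_(k | k != i) denq (u 0 k).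
have cE i : (c i)%:~R = u 0 i * (\prod_k denq (u 0 k))%:~R :> rat.
  rewrite (bigD1 i) //= /c !rmorphM /= -{2}(divq_num_den (u 0 i)).
  by rewrite mulrA divfK // intr_eq0 denq_eq0.
have c0 i : c i = 0.
  apply: indep => j; apply/eqP; rewrite -(intr_eq0 rat) rmorph_sum /=.
  apply/eqP; transitivity ((u *m charmx f) 0 j * (\prod_k denq (u 0 k))%:~R).
    rewrite mxE mulr_suml; apply: eq_bigr => k _.
    by rewrite rmorphM /= cE !mxE mulrAC.
  by rewrite uA mxE mul0r.
apply/rowP => i; rewrite [RHS]mxE; have /eqP := c0 i; rewrite mulf_eq0.
case/orP => [|/eqP p0]; first by rewrite numq_eq0 => /eqP.
have : \prod_(k | k != i) denq (u 0 k) != 0.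
  by apply/prodf_neq0 => k _; rewrite denq_neq0.
by rewrite p0 eqxx.
Qed.

(* For [N = q - 1] this is dual to the surjectivity of the monomial map onto the
   projective torus of [P^(s-1)], whose character group consists of the [c] in
   [(Z/N)^s] with sum [0]. *)
Definition indep_mod (N : nat) : Prop :=
  forall c : 'I_s -> int, (N%:Z %| \sum_i c i)%Z ->
  (forall j, (N%:Z %| \sum_i c i * charvec f i j)%Z) ->
  forall i, (N%:Z %| c i)%Z.

Lemma sum_charvecB (i0 : 'I_s) (c : 'I_s -> int) j :
  \sum_(i | i != i0) c i * (charvec f i j - charvec f i0 j) =
  \sum_i c i * charvec f i j - (\sum_i c i) * charvec f i0 j.
Proof.
rewrite mulr_suml -sumrB [RHS](bigD1 i0) //= subrr add0r.
by apply: eq_bigr => i _; rewrite mulrBr.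
Qed.

(** The hypotheses on c make the element of L with coefficients c equal to N a for an integral
    vector a. Injectivity puts a in L, with coefficients d, and independence gives c_i = N d_i for i
    != i0. *)
Lemma indep_mod_of_phi_injective i0 q :
  row_free (charmx f) -> phi_injective f i0 q -> (1 < q)%N -> indep_mod q.-1.
Proof.
move=> /row_free_charmxP indep phi q1 c cs cv.
pose N := q.-1.
have N0 : N%:Z != 0 by rewrite /N; lia.
pose a j := ((\sum_i c i * charvec f i j - (\sum_i c i) * charvec f i0 j) %/ N)%Z.
have aE j : N%:Z * a j = \sum_i c i * charvec f i j - (\sum_i c i) * charvec f i0 j.
  by rewrite mulrC divzK // rpredB // dvdz_mulr.
have [|d dE] := phi a (fun=> 0).
  by exists c => j; rewrite sum_charvecB -aE mulr0 subr0.
pose e i := c i - N%:Z * d i.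
have e0 : forall i, i != i0 -> e i = 0.
  (* A relation among the [v_i - v_i0] becomes one among the [v_i] once its [i0]
     entry is chosen to make the sum zero. *)
  pose e' i := if i == i0 then - \sum_(k | k != i0) e k else e i.
  have e'0 : forall i, e' i = 0.
    apply: indep => j.
    transitivity (\sum_(i | i != i0) e i * (charvec f i j - charvec f i0 j)).
      rewrite (bigD1 i0) //= /e' eqxx mulNr mulr_suml addrC -sumrB.
      by apply: eq_bigr => i /negbTE ->; rewrite mulrBr.
    rewrite /e; under eq_bigr do rewrite mulrBl.
    rewrite sumrB sum_charvecB -aE; apply/eqP; rewrite subr_eq0.
    have := dE j; rewrite subr0 => ->; rewrite mulr_sumr; apply/eqP.
    by apply: eq_bigr => i _; rewrite mulrA.
  by move=> i /negbTE ii0; have := e'0 i; rewrite /e' ii0.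
have dvd i : i != i0 -> (N%:Z %| c i)%Z.
  by move=> /e0/eqP; rewrite subr_eq0 => /eqP ->; apply: dvdz_mulr.
(* The coefficient at [i0] is divisible because the total sum and all other coefficients are. *)
move=> i; case: (eqVneq i i0) => [->|/dvd //].
by move: cs; rewrite (bigD1 i0) //= rpredDr // rpred_sum.
Qed.

(** If N (a - b) lies in L, its coefficients, completed at [i0] to have sum zero, satisfy the
    hypotheses of [indep_mod], so the expression can be divided by N. *)
Lemma phi_injective_of_indep_mod i0 q :
  (1 < q)%N -> indep_mod q.-1 -> phi_injective f i0 q.
Proof.
move=> q1 indep a b [c cE].
have N0 : (q.-1)%:Z != 0 by lia.
pose c' i := if i == i0 then - \sum_(k | k != i0) c k else c i.
have dvd i : ((q.-1)%:Z %| c' i)%Z.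
  have sum0 : \sum_i c' i = 0.
    rewrite (bigD1 i0) //= /c' eqxx addrC; apply/eqP; rewrite subr_eq0.
    by apply/eqP/eq_bigr => k /negbTE ->.
  apply: indep => [|j]; first by rewrite sum0.
  have := sum_charvecB i0 c' j; rewrite sum0 mul0r subr0 => <-.
  rewrite (eq_bigr (fun i => c i * (charvec f i j - charvec f i0 j))).
    by rewrite -cE -mulrBr dvdz_mulr.
  by move=> k /negbTE ki; rewrite /c' ki.
exists (fun i => (c i %/ (q.-1)%:Z)%Z) => j; apply: (mulfI N0).
rewrite mulrBr cE mulr_sumr; apply: eq_bigr => i /negbTE ii0.
by rewrite mulrA [_ * (_ %/ _)%Z]mulrC divzK //; have := dvd i; rewrite /c' ii0.
Qed.

(* An integer relation is divisible by [N], and dividing it by [N] yields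
   another relation; hence it is divisible by all powers of [N]. *)
Lemma row_free_of_indep_mod N :
  (1 < N)%N -> (1 < s)%N -> is_clutter f -> uniform_clutter f -> indep_mod N ->
  row_free (charmx f).
Proof.
move=> N1 s1 clu uni indep; apply/row_free_charmxP => c c0 i.
have N0 : N%:Z != 0 by lia.
(* An empty edge would lie inside any other edge. *)
have fi0 l : (0 < #|f l|)%N.
  rewrite card_gt0; apply/eqP => fl0.
  pose k : 'I_s := if l == Ordinal s1 then Ordinal (ltnW s1) else Ordinal s1.
  have lk : l != k by rewrite /k; case: (eqVneq l (Ordinal s1)) => [->|].
  by have := clu _ _ lk; rewrite fl0 sub0set.
(* Adding all coordinates of a relation gives the common edge size times the sum of its
   coefficients. *)
have sum0 (d : 'I_s -> int) :
    (forall j, \sum_i d i * charvec f i j = 0) -> \sum_i d i = 0.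
  move=> d0; have : \sum_i d i * (#|f i|)%:Z = 0.
    transitivity (\sum_j \sum_i d i * charvec f i j); last by rewrite big1.
    rewrite exchange_big; apply: eq_bigr => l _; rewrite -mulr_sumr.
    congr (_ * _); rewrite -sum1_card big_mkcond /= rmorph_sum /=.
    by apply: eq_bigr => j _; rewrite /charvec; case: (j \in _).
  under eq_bigr => l _ do rewrite (uni l i).
  rewrite -mulr_suml => /eqP; rewrite mulf_eq0 => /orP [/eqP //|].
  by have := fi0 i; lia.
have pw k : forall d : 'I_s -> int,
    (forall j, \sum_i d i * charvec f i j = 0) -> (N%:Z ^+ k %| d i)%Z.
  elim: k => [|k IH] d d0; first by rewrite expr0 dvd1z.
  have dvd : forall l, (N%:Z %| d l)%Z.
    by apply: indep => [|j]; rewrite ?(sum0 _ d0) ?d0 ?dvdz0.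
  rewrite -(divzK (dvd i)) exprSr dvdz_mul //.
  apply: (IH (fun l => (d l %/ N)%Z)) => j; apply: (mulfI N0).
  rewrite mulr0 -[RHS](d0 j) mulr_sumr; apply: eq_bigr => l _.
  by rewrite mulrA [_ * (_ %/ _)%Z]mulrC divzK.
(* The power is chosen so that N ^ |c_i| > |c_i|, which forces c_i = 0. *)
have := pw `|c i|%N c c0; rewrite /dvdz abszX /= => /dvdn_leq h.
apply/eqP; rewrite -absz_eq0 -leqn0 leqNgt; apply/negP => /h.
by rewrite leqNgt ltn_expl.
Qed.

End Lattice.

(** * The vanishing ideal of the projective torus *)

Section TorusIdeal.
Variables (K : finFieldType) (s : nat) (i0 : 'I_s).
Local Notation N := (#|K|.-1).

Definition binom (a b : mon s) : mpoly K s := [:: (a, 1); (b, -1)].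

Lemma psum_binom a b F : psum (binom a b) F = F a - F b.
Proof. by rewrite !psum_cons psum_nil /= mul1r mulN1r addr0. Qed.

Lemma mcoef_binom a b m : mcoef (binom a b) m = (a == m)%:R - (b == m)%:R.
Proof. by rewrite mcoefE psum_binom. Qed.

Lemma binom_deg a b m :
  mdeg a = mdeg b -> mcoef (binom a b) m != 0 -> mdeg m = mdeg a.
Proof.
move=> ab; rewrite mcoef_binom; case: (eqVneq a m) => [-> //|_].
by case: (eqVneq b m) => [<- //|_]; rewrite subrr eqxx.
Qed.

(** [lift i0] enumerates the indices other than [i0], which gives exactly s - 1 generators. *)
Definition torus_gen (k : 'I_s.-1) : mpoly K s :=
  binom (mpow (lift i0 k) N) (mpow i0 N).

Lemma torus_gen_deg k m : mcoef (torus_gen k) m != 0 -> mdeg m = N.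
Proof. by move/binom_deg; rewrite !mdeg_mpow; apply. Qed.

Lemma unit_expf_dvd (z : K) e : z != 0 -> (N %| e)%N -> z ^+ e = 1.
Proof.
by move=> z0 /dvdnP [k ->]; rewrite mulnC exprM unit_expf_card // expr1n.
Qed.

Lemma peval_torus_gen k (y : 'I_s -> K) :
  (forall i, y i != 0) -> peval (torus_gen k) y = 0.
Proof.
by move=> y0; rewrite pevalE psum_binom !prod_mpow !unit_expf_card // subrr.
Qed.

Lemma torus_pt_neq0 n (f : 'I_s -> {set 'I_n}) (x : 'I_n -> K) :
  (forall j, x j != 0) -> forall i, torus_pt f x i != 0.
Proof. by move=> x0 i; apply/prodf_neq0 => j _. Qed.

Lemma in_IX_vanishes n (f : 'I_s -> {set 'I_n}) (p : mpoly K s) :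
  in_IX f p -> vanishes_on_X f p.
Proof.
move=> [k [g [gP gp]]] x x0; apply: peval_in_ideal gp => i.
by have [_] := gP i; apply.
Qed.

Lemma in_IX_hom n (f : 'I_s -> {set 'I_n}) (p : mpoly K s) :
  homogeneous p -> vanishes_on_X f p -> in_IX f p.
Proof.
move=> hp vp; exists 1%N, (fun=> p); split=> //.
exact: (@in_ideal_gen K s 1 (fun=> p) 0).
Qed.

(** Congruence of monomials modulo the ideal generated by [torus_gen]. *)
Local Notation eqI a b := (in_ideal torus_gen (binom a b)).

Lemma eqI_refl a : eqI a a.
Proof.
apply: in_ideal_peq (in_ideal0 _).
by apply/peqP => F; rewrite psum_binom subrr psum_nil.
Qed.

Lemma eqI_trans a b c : eqI a b -> eqI b c -> eqI a c.
Proof.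
move=> ab bc; apply: in_ideal_peq (in_ideal_cat ab bc).
by apply/peqP => F; rewrite psum_cat !psum_binom addrA subrK.
Qed.

Lemma eqI_addl c a b : eqI a b -> eqI (mon_add c a) (mon_add c b).
Proof.
move=> ab; apply: in_ideal_peq (in_ideal_mul [:: (c, 1)] ab).
apply/peqP => F; rewrite psum_pmul psum_binom psum_cons psum_nil psum_binom /=.
by rewrite mul1r addr0.
Qed.

Lemma eqI_add a a' b b' :
  eqI a a' -> eqI b b' -> eqI (mon_add a b) (mon_add a' b').
Proof.
move=> aa' bb'; apply: (eqI_trans (eqI_addl a bb')).
by rewrite !(mon_addC _ b'); apply: eqI_addl.
Qed.

Lemma eqI_mpow i e : eqI (mpow i (N * e)) (mpow i0 (N * e)).
Proof.
elim: e => [|e IH]; first by rewrite muln0 !mpow0; apply: eqI_refl.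
rewrite mulnS !mpow_add; apply: eqI_add => //.
case: (unliftP i0 i) => [k|] ->; last exact: eqI_refl.
exact: in_ideal_gen.
Qed.

Lemma big_mon_addE (P : pred 'I_s) (F : 'I_s -> mon s) j :
  (\big[@mon_add s/mon0 s]_(i | P i) F i) j = (\sum_(i | P i) F i j)%N.
Proof. by apply: (big_morph (fun m : mon s => m j)) => [a b|]; rewrite ffunE. Qed.

(* Normal form modulo the [torus_gen]: exponents off [i0] are reduced mod [N],
   and the degree removed is moved to [i0]. *)
Definition nform (m : mon s) : mon s :=
  mon_add [ffun i => if i == i0 then m i else (m i %% N)%N]
          (mpow i0 (\sum_(i | i != i0) N * (m i %/ N))).

Lemma eqI_nform m : eqI m (nform m).
Proof.
(* Division by N off [i0] writes m as its reduced part times powers of the t_i ^ N, which are then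
   replaced one by one by powers of t_i0 ^ N. *)
have {1}-> : m = mon_add [ffun i => if i == i0 then m i else (m i %% N)%N]
    (\big[@mon_add s/mon0 s]_(i | i != i0) mpow i (N * (m i %/ N))).
  apply/ffunP => j; rewrite ffunE big_mon_addE ffunE.
  case: (eqVneq j i0) => [->|ji].
    rewrite big1 ?addn0 // => i; rewrite ffunE eq_sym => /negbTE ->.
    by [].
  rewrite (bigD1 j) //= ffunE eqxx big1 => [|i /andP [_]].
    by rewrite addn0 addnC mulnC -divn_eq.
  by rewrite ffunE eq_sym => /negbTE ->.
apply: eqI_addl.
rewrite (big_morph (mpow i0) (mpow_add i0) (mpow0 i0)).
apply: (big_ind2 (fun a b => eqI a b)).
- exact: eqI_refl.
- by move=> a a' b b'; apply: eqI_add.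
by move=> i _; apply: eqI_mpow.
Qed.

Lemma nform_neq m i : i != i0 -> nform m i = (m i %% N)%N.
Proof. by move=> /negbTE ii0; rewrite !ffunE ii0 addn0. Qed.

Lemma nform_cong m i : nform m i = m i %[mod N].
Proof.
case: (eqVneq i i0) => [->|/nform_neq ->]; last by rewrite modn_mod.
by rewrite !ffunE eqxx -big_distrr /= addnC mulnC modnMDl.
Qed.

Lemma mdeg_nform m : mdeg (nform m) = mdeg m.
Proof.
rewrite mdeg_add mdeg_mpow /mdeg (bigD1 i0) //= ffunE eqxx.
rewrite [RHS](bigD1 i0) //= -addnA -big_split /=; congr (_ + _)%N.
apply: eq_bigr => i /negbTE ii0; rewrite ffunE ii0 addnC mulnC.
by rewrite -divn_eq.
Qed.

Lemma eq_mon_off (m m' : mon s) :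
  mdeg m = mdeg m' -> (forall i, i != i0 -> m i = m' i) -> m = m'.
Proof.
move=> dm off; apply/ffunP => i; case: (eqVneq i i0) => [->|/off //].
move: dm; rewrite /mdeg (bigD1 i0) //= [RHS](bigD1 i0) //= => /eqP.
by rewrite (eq_bigr m') // eqn_add2r => /eqP.
Qed.

Lemma eq_nform (m m' : mon s) :
  mdeg m = mdeg m' -> (forall i, m i = m' i %[mod N]) -> nform m = nform m'.
Proof.
move=> dm mm'; apply: eq_mon_off => [|i ii0]; first by rewrite !mdeg_nform.
by rewrite !nform_neq.
Qed.

Lemma nform_idem m : nform (nform m) = nform m.
Proof. by apply: eq_nform; [apply: mdeg_nform|apply: nform_cong]. Qed.

(** Modulo the ideal, p equals the polynomial with every monomial replaced by its normal form, and
    the hypothesis says that this polynomial is zero. *)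
Lemma in_ideal_nform (p : mpoly K s) :
  (forall m', psum p (fun m => (nform m == m')%:R) = 0) ->
  in_ideal torus_gen p.
Proof.
move=> p0.
have nf0 F : psum p (F \o nform) = 0.
  have -> : psum p (F \o nform) = psum [seq (nform t.1, t.2) | t <- p] F.
    by rewrite /psum big_map.
  have /peqP -> : peq [seq (nform t.1, t.2) | t <- p] [::].
    by move=> m; rewrite !mcoefE psum_nil -[RHS](p0 m) /psum big_map.
  exact: psum_nil.
have [w [wI wE]] : exists w, in_ideal torus_gen w /\
    forall F, psum w F = psum p F - psum p (F \o nform).
  elim: p {p0 nf0} => [|[m c] p [w [wI wE]]].
    by exists [::]; split=> [|F]; [apply: in_ideal0|rewrite !psum_nil subrr].
  exists (pmul [:: (mon0 s, c)] (binom m (nform m)) ++ w); split.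
    exact/in_ideal_cat/wI/in_ideal_mul/eqI_nform.
  move=> F; rewrite psum_cat psum_pmul wE psum_cons psum_nil psum_binom !psum_cons /=.
  by rewrite !mon_add0m; ring.
by apply: in_ideal_peq wI; apply/peqP => F; rewrite wE nf0 subr0.
Qed.

Lemma sum_charvec n (f : 'I_s -> {set 'I_n}) (a : mon s) j :
  \sum_i (a i)%:Z * charvec f i j = (toric_exp f a j)%:Z.
Proof.
rewrite ffunE rmorph_sum /=; apply: eq_bigr => i _.
by rewrite /charvec -rmorphM.
Qed.

(** Within one degree, [indep_mod] makes monomials with congruent exponents in x have the same
    normal form. The sums over normal form classes are therefore those of [vanishes_class]. *)
Lemma vanishes_in_torus_ideal n (f : 'I_s -> {set 'I_n}) (p : mpoly K s) :
  indep_mod f N -> homogeneous p -> vanishes_on_X f p ->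
  in_ideal torus_gen p.
Proof.
move=> indep [d dp] vp; apply: in_ideal_nform => m'.
(* If m' is not reduced or has the wrong degree, no monomial of p has it as normal form. *)
case: (boolP ((nform m' == m') && (mdeg m' == d))); last first.
  move=> nm'; rewrite (@eq_psum_coef _ _ _ _ (fun=> 0)); last first.
    move=> m /dp dm; case: eqP => // mm'; case/negP: nm'.
    by rewrite -mm' nform_idem mdeg_nform dm !eqxx.
  by rewrite /psum big1 // => t _; rewrite mulr0.
case/andP => /eqP nm' /eqP dm'.
rewrite -[RHS](vanishes_class (toric_exp f m') vp).
apply: eq_psum_coef => m /dp dm; congr (_%:R : K); congr nat_of_bool.
apply/eqP/forallP => [mm' j|tor].
  rewrite !ffunE; apply/eqP.
  apply: (big_ind2 (fun a b => a = b %[mod N])) => // [a a' b b' aa' bb'|i _].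
    by rewrite -modnDm aa' bb' modnDm.
  by rewrite -modnMml -(nform_cong m i) mm' modnMml.
rewrite -nm'; apply: eq_nform; first by rewrite dm dm'.
(* The equality of degrees supplies the condition of [indep_mod] on the sum of the coefficients. *)
have dvd : forall i, (N%:Z %| (m i)%:Z - (m' i)%:Z)%Z.
  apply: indep => [|j].
    by rewrite sumrB -!rmorph_sum /= -!/(mdeg _) dm dm' subrr dvdz0.
  under eq_bigr => i _ do rewrite mulrBl.
  rewrite sumrB -eqz_mod_dvd.
  by rewrite !sum_charvec !modz_nat; apply: tor.
move=> i; have := dvd i; rewrite -eqz_mod_dvd !modz_nat => /eqP [].
by [].
Qed.

End TorusIdeal.

(** * Consequences of having s - 1 homogeneous generators *)

Section CompleteIntersection.
Variables (K : finFieldType) (n s : nat) (i0 : 'I_s) (f : 'I_s -> {set 'I_n}).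
Local Notation N := (#|K|.-1).

Lemma toric_exp_le (m : mon s) j : (toric_exp f m j <= mdeg m)%N.
Proof.
rewrite ffunE; apply: leq_sum => i _.
by case: (j \in f i); rewrite ?muln1 ?muln0.
Qed.

Lemma toric_exp_mpow i d j : toric_exp f (mpow i d) j = (d * (j \in f i))%N.
Proof.
rewrite ffunE (bigD1 i) //= ffunE eqxx big1 ?addn0 // => k /negbTE ki.
by rewrite ffunE ki.
Qed.

(* A monomial of degree [d] with the exponent [d v_i] only involves edges that
   contain [f_i]. *)
Lemma toric_exp_eq_mpow (m : mon s) i :
  is_clutter f ->
  (forall j, toric_exp f m j = (mdeg m * (j \in f i))%N) -> m = mpow i (mdeg m).
Proof.
(* At a vertex of f_i outside f_k, the exponent can reach the degree of m only if t_k is absent from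
   m. *)
move=> clu tor; have off k : k != i -> m k = 0%N.
  rewrite eq_sym => /clu/subsetPn [j ji jk].
  have := tor j; rewrite ji muln1 ffunE /mdeg (bigD1 k) //= [RHS](bigD1 k) //=.
  rewrite (negbTE jk) muln0 add0n => le.
  have : (\sum_(l | l != k) m l * (j \in f l) <= \sum_(l | l != k) m l)%N.
    by apply: leq_sum => l _; case: (j \in f l); rewrite ?muln1 ?muln0.
  by rewrite le -[X in (_ <= X)%N]add0n leq_add2r leqn0 => /eqP.
apply: (@eq_mon_off _ i) => [|k ki]; first by rewrite mdeg_mpow.
by rewrite ffunE (negbTE ki) off.
Qed.

(** Below degree N, exponents congruent modulo N are equal, so the class of t_i ^ d in
    [vanishes_class] contains no other monomial of degree d. *)
Lemma mcoef_mpow_vanishes (p : mpoly K s) d i :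
  is_clutter f -> (d < N)%N -> (forall m, mcoef p m != 0 -> mdeg m = d) ->
  vanishes_on_X f p -> mcoef p (mpow i d) = 0.
Proof.
move=> clu dN dp vp; rewrite -[RHS](vanishes_class (toric_exp f (mpow i d)) vp).
rewrite mcoefE; apply: eq_psum_coef => m /dp dm.
congr (_%:R : K); congr nat_of_bool.
apply/eqP/forallP => [-> //|tor].
rewrite -dm; apply: toric_exp_eq_mpow => // j; have := tor j.
have le1 := toric_exp_le m j; have le2 := toric_exp_le (mpow i d) j.
rewrite mdeg_mpow in le2.
rewrite !modn_small ?toric_exp_mpow ?dm => [/eqP //||].
  by rewrite -toric_exp_mpow (leq_ltn_trans le2).
by rewrite (leq_ltn_trans le1) // dm.
Qed.

Section Generators.
Variables (g : 'I_s.-1 -> mpoly K s) (d : 'I_s.-1 -> nat).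
Hypothesis clu : is_clutter f.
Hypothesis gd : forall k m, mcoef (g k) m != 0 -> mdeg m = d k.
Hypothesis gv : forall k, vanishes_on_X f (g k).

Lemma psum_shift_deg k a m : d k = N -> mdeg m = N ->
  psum (g k) (fun b => (mon_add a b == m)%:R) =
  (a == mon0 s)%:R * mcoef (g k) m.
Proof.
move=> dk dm; rewrite mcoefE -psumZ; apply: eq_psum_coef => b /gd db.
case: (eqVneq a (mon0 s)) => [->|a0]; first by rewrite mon_add0m mul1r.
rewrite mul0r; case: eqP => // abm; case/negP: a0.
by rewrite -mdeg_eq0 -(eqn_add2r (mdeg b)) -mdeg_add abm dm db dk.
Qed.

(** A factor of t_i ^ N is a pure power of degree at most N; if [g k] has degree below N, its pure
    powers have coefficient zero. *)
Lemma psum_shift_mpow k a i : d k != N ->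
  psum (g k) (fun b => (mon_add a b == mpow i N)%:R) = 0.
Proof.
move=> dk; rewrite (@eq_psum_coef _ _ _ _ (fun=> 0)).
  by rewrite /psum big1 // => t _; rewrite mulr0.
move=> b gb; have db := gd gb; case: eqP => // abm; case/negP: gb.
have [_ bE] := mon_add_mpow abm; rewrite bE db.
rewrite (mcoef_mpow_vanishes i clu _ (@gd k) (@gv k)) //.
rewrite ltn_neqAle dk /= -db -(mdeg_mpow i N) -abm mdeg_add.
exact: leq_addl.
Qed.

(* Comparing the coefficients of pure powers [t_i ^ N] shows that the [torus_gen]
   are independent combinations of those [g k] that have degree [N]. *)
Lemma ci_gens_in_torus_ideal :
  (forall k, in_ideal g (torus_gen K i0 k)) ->
  forall k, in_ideal (torus_gen K i0) (g k).
Proof.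
move=> tg; have N0 := card_units_gt0 K.
have [h hP] := fin_all_exists (fun i => proj1 (in_idealP g _) (tg i)).
(* At the pure powers t_l ^ N only constant terms of multipliers contribute, which turns [hP] into
   [M *m G = 1]. *)
pose M := \matrix_(i, k) (if d k == N then mcoef (h i k) (mon0 s) else 0).
pose G := \matrix_(k, l) mcoef (g k) (mpow (lift i0 l) N).
have shiftN i k m : d k = N -> mdeg m = N ->
    psum (h i k) (fun a => psum (g k) (fun b => (mon_add a b == m)%:R)) =
    M i k * mcoef (g k) m.
  move=> dk dm; under eq_psum do rewrite (psum_shift_deg _ dk dm) mulrC.
  by rewrite psumZ mulrC mxE dk eqxx -mcoefE.
have mpow_inj i j : (mpow i N == mpow j N) = (i == j).
  apply/eqP/eqP => [/ffunP/(_ i)|-> //]; rewrite !ffunE eqxx.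
  by case: eqP => // _ e; rewrite e in N0.
have MG : M *m G = 1%:M.
  apply/matrixP => i l; rewrite !mxE.
  transitivity (mcoef (torus_gen K i0 i) (mpow (lift i0 l) N)).
    rewrite mcoefE hP; apply: eq_bigr => k _.
    have [dk|dk] := eqVneq (d k) N; first by rewrite shiftN ?mdeg_mpow ?mxE.
    under eq_psum do rewrite psum_shift_mpow //.
    rewrite !mxE (negbTE dk) mul0r.
    by rewrite /psum big1 // => t _; rewrite mulr0.
  rewrite mcoef_binom !mpow_inj (inj_eq lift_inj).
  by rewrite (negbTE (neq_lift _ _)) subr0.
(* The number s - 1 of generators enters here: both matrices are square. *)
have GM := mulmx1C MG.
(* A generator of another degree would give a zero column of [M], hence of [G *m M]. *)
have dN k : d k = N.
  apply/eqP; apply: contraT => dk; have /matrixP/(_ k k)/eqP := GM.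
  rewrite !mxE eqxx big1 => [|i _]; first by rewrite eq_sym oner_eq0.
  by rewrite !mxE (negbTE dk) mulr0.
have coefM i m : mdeg m = N ->
    mcoef (torus_gen K i0 i) m = \sum_k M i k * mcoef (g k) m.
  by move=> dm; rewrite mcoefE hP; apply: eq_bigr => k _; rewrite shiftN.
(* In degree N this inverts [coefM]; in other degrees both sides vanish. *)
have coefG k m : mcoef (g k) m = \sum_i G k i * mcoef (torus_gen K i0 i) m.
  have [dm|dm] := eqVneq (mdeg m) N; last first.
    rewrite big1 => [|i _].
      by apply/eqP; apply: contraR dm => /gd ->; rewrite dN.
    apply/eqP; rewrite mulf_eq0; apply/orP; right.
    by apply: contraR dm => /torus_gen_deg ->.
  under eq_bigr => i _ do rewrite coefM // mulr_sumr.
  rewrite exchange_big /=.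
  transitivity (\sum_k' (G *m M) k k' * mcoef (g k') m).
    rewrite GM (bigD1 k) //= !mxE eqxx mul1r big1 ?addr0 // => k' /negbTE kk'.
    by rewrite mxE eq_sym kk' mul0r.
  apply: eq_bigr => k' _; rewrite mxE mulr_suml.
  by apply: eq_bigr => i _; rewrite mulrA.
move=> k; exists (fun i => [:: (mon0 s, G k i)]) => m.
rewrite coefG [RHS]mcoefE psum_plincomb; apply: eq_bigr => i _.
rewrite [RHS]psum_cons psum_nil addr0 mcoefE /=; congr (_ * _).
by apply: eq_psum => b; rewrite mon_add0m.
Qed.

End Generators.

(** The class c modulo N gives a binomial whose two monomials are both 1 on X. It lies in I(X),
    hence in the torus ideal, so it vanishes on the whole torus; points with a single coordinate
    other than 1 then show that N divides each c_i. *)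
Lemma ci_indep_mod :
  is_clutter f -> IX_complete_intersection K f -> indep_mod f N.
Proof.
move=> clu [g [gh gI]] c cs cv.
have N0 := card_units_gt0 K.
have gX k : in_IX f (g k) by apply/gI/in_ideal_gen.
have [d gd] := fin_all_exists gh.
have gt k : in_ideal g (torus_gen K i0 k).
  apply/gI/in_IX_hom; first by exists N; apply: torus_gen_deg.
  by move=> x x0; apply/peval_torus_gen/torus_pt_neq0.
have gT := ci_gens_in_torus_ideal clu gd (fun k => in_IX_vanishes (gX k)) gt.
(* Residues modulo N turn the integers c_i into admissible exponents. *)
pose a : mon s := [ffun i => `|(c i %% N)%Z|%N].
have aE i : (a i)%:Z = (c i %% N)%Z.
  by rewrite ffunE gez0_abs // modz_ge0 // eqz_nat -lt0n.
have dvda (F : 'I_s -> int) : (N%:Z %| \sum_i c i * F i)%Z ->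
    (N%:Z %| \sum_i (a i)%:Z * F i)%Z.
  move=> cF.
  have -> : \sum_i (a i)%:Z * F i =
      \sum_i c i * F i - \sum_i (c i %/ N)%Z * N%:Z * F i.
    rewrite -sumrB; apply: eq_bigr => i _.
    by rewrite aE /modz mulrBl.
  by rewrite rpredB // rpred_sum // => i _; rewrite mulrAC dvdz_mull.
have dvd_mdeg : (N %| mdeg a)%N.
  have := dvda (fun=> 1); rewrite -!mulr_suml !mulr1.
  by rewrite -rmorph_sum; apply.
have dvd_tor j : (N %| toric_exp f a j)%N.
  by have := dvda _ (cv j); rewrite sum_charvec.
have : in_ideal g (binom K a (mpow i0 (mdeg a))).
  apply/gI/in_IX_hom.
    by exists (mdeg a) => m /binom_deg; apply; rewrite mdeg_mpow.
  move=> x x0; rewrite pevalE psum_binom prod_torus_pt prod_mpow big1.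
    by rewrite unit_expf_dvd ?subrr // torus_pt_neq0.
  by move=> j _; rewrite unit_expf_dvd.
move=> ga i; rewrite (divz_eq (c i) N) -aE rpredD ?dvdz_mull //.
apply: dvdn_unit_exp => z z0; pose y l := if l == i then z else 1.
have yi : y i = z by rewrite /y eqxx.
have y0 l : y l != 0 by rewrite /y; case: ifP => // _; apply: oner_neq0.
have := peval_in_ideal (y := y) _ ga; rewrite pevalE psum_binom prod_mpow.
rewrite (unit_expf_dvd (y0 _) dvd_mdeg) (bigD1 i) //= yi big1 => [|l li].
  rewrite mulr1 => h; apply/eqP; rewrite -subr_eq0 h // => k.
  by apply: peval_in_ideal (gT k) => l; apply: peval_torus_gen.
by rewrite /y (negbTE li) expr1n.
Qed.

End CompleteIntersection.

Theorem theorem3p9 (K : finFieldType) (n s : nat) (hs : (2 <= s)%N)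
    (f : 'I_s -> {set 'I_n}) :
  is_clutter f -> uniform_clutter f -> (3 <= #|K|)%N ->
  (IX_complete_intersection K f <->
   (row_free (charmx f) /\ phi_injective f (Ordinal (ltnW hs)) #|K|)).
Proof.
move=> clu uni q3; set i0 := Ordinal _; have q1 := ltnW q3.
split=> [ci|[rf phi]].
  have indep := ci_indep_mod i0 clu ci.
  split; last exact: phi_injective_of_indep_mod.
  (* The assumption q >= 3 is what gives N > 1. *)
  by apply: row_free_of_indep_mod indep => //; rewrite -ltnS succ_card_units.
have indep := indep_mod_of_phi_injective rf phi q1.
exists (torus_gen K i0); split=> [k|p].
  by exists #|K|.-1; apply: torus_gen_deg.
split=> [[k [g [gP [h hP]]]]|pI].
  apply: in_ideal_peq hP _; apply: in_ideal_comb => i.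
  by have [gh gv] := gP i; apply: vanishes_in_torus_ideal gh gv.
exists s.-1, (torus_gen K i0); split=> // k.
split; first by exists #|K|.-1; apply: torus_gen_deg.
by move=> x x0; apply/peval_torus_gen/torus_pt_neq0.
Qed.
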